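(* Work over a field $\mathbf{k}$ of characteristic $0$. There is a one-to-one correspondence between skeletal morphism sh Lie algebras and triples of the form $((\mathfrak{g},\mathfrak{h},\phi),(V,W,\psi),(\theta,\gamma,\eta))$ in which $(\mathfrak{g},\mathfrak{h},\phi)$ is a morphism Lie algebra, $(V,W,\psi)$ is a representation of it and $(\theta,\gamma,\eta)\in Z^3_{\mathsf{mLA}}(\phi,\psi)$ is a $3$-cocycle. Moreover, it extends to a one-to-one correspondence between equivalence classes of skeletal morphism sh Lie algebras and triples $((\mathfrak{g},\mathfrak{h},\phi),(V,W,\psi),[(\theta,\gamma,\eta)])$, where $(\mathfrak{g},\mathfrak{h},\phi)$ is a morphism Lie algebra, $(V,W,\psi)$ is a representation of it and $[(\theta,\gamma,\eta)]\in H^3_{\mathsf{mLA}}(\phi,\psi)$.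
   Context: A morphism Lie algebra is a triple $(\mathfrak{g},\mathfrak{h},\phi)$ of two Lie algebras and a Lie algebra homomorphism $\phi:\mathfrak{g}\to\mathfrak{h}$. A representation of it is a triple $(V,W,\psi)$ with $V$ a representation of $\mathfrak{g}$ (action $\rho_V$), $W$ a representation of $\mathfrak{h}$ (action $\rho_W$) and $\psi:V\to W$ linear with $\psi(\rho_V(x)v)=\rho_W(\phi(x))\psi(v)$. $W_\phi$ denotes $W$ as a representation of $\mathfrak{g}$ via $x\mapsto\rho_W(\phi(x))$. Cohomology. For a representation $(V,\rho)$ of a Lie algebra, the Chevalley–Eilenberg differential is $(\delta_{\mathsf{CE}}f)(x_1,\ldots,x_{n+1})=\sum_i(-1)^{i+1}\rho(x_i)f(\ldots,\widehat{x_i},\ldots)+\sum_{i<j}(-1)^{i+j}f([x_i,x_j],\ldots,\widehat{x_i},\ldots,\widehat{x_j},\ldots)$. Let $\delta'_{\mathsf{CE}},\delta''_{\mathsf{CE}},\delta'''_{\mathsf{CE}}$ be the differentials for $\mathfrak{g}$ with values in $V$, $\mathfrak{h}$ with values in $W$, and $\mathfrak{g}$ with values in $W_\phi$. For $n\ge1$, $C^n_{\mathsf{mLA}}(\phi,\psi)=\mathrm{Hom}(\wedge^n\mathfrak{g},V)\oplus\mathrm{Hom}(\wedge^n\mathfrak{h},W)\oplus\mathrm{Hom}(\wedge^{n-1}\mathfrak{g},W)$ with $\delta_{\mathsf{mLA}}(\theta,\gamma,\eta)=(\delta'_{\mathsf{CE}}\theta,\delta''_{\mathsf{CE}}\gamma,\psi\circ\theta-\gamma\circ\wedge^n\phi-\delta'''_{\mathsf{CE}}\eta)$.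 $Z^3_{\mathsf{mLA}}$ is the kernel of $\delta_{\mathsf{mLA}}$ on $C^3_{\mathsf{mLA}}$ and $H^3_{\mathsf{mLA}}=Z^3_{\mathsf{mLA}}/\delta_{\mathsf{mLA}}(C^2_{\mathsf{mLA}})$. A $2$-term sh Lie algebra $\mathcal{G}=(\mathfrak{g}_1\xrightarrow{d}\mathfrak{g}_0,l_2,l_3)$ consists of a chain complex $\mathfrak{g}_1\xrightarrow{d}\mathfrak{g}_0$, a skew-symmetric bilinear map $l_2:\mathfrak{g}_i\otimes\mathfrak{g}_j\to\mathfrak{g}_{i+j}$ ($0\le i+j\le1$) and a skew-symmetric trilinear map $l_3:\mathfrak{g}_0\otimes\mathfrak{g}_0\otimes\mathfrak{g}_0\to\mathfrak{g}_1$ such that for $x,y,z,t\in\mathfrak{g}_0$, $p,q\in\mathfrak{g}_1$: (i) $dl_2(x,p)=l_2(x,dp)$; (ii) $l_2(dp,q)=l_2(p,dq)$; (iii) $dl_3(x,y,z)=l_2(x,l_2(y,z))+l_2(y,l_2(z,x))+l_2(z,l_2(x,y))$; (iv) $l_3(x,y,dp)=l_2(x,l_2(y,p))+l_2(y,l_2(p,x))+l_2(p,l_2(x,y))$; (v) $l_2(x,l_3(y,z,t))-l_2(y,l_3(x,z,t))+l_2(z,l_3(x,y,t))-l_2(t,l_3(x,y,z))-l_3(l_2(x,y),z,t)+l_3(l_2(x,z),y,t)-l_3(l_2(x,t),y,z)-l_3(l_2(y,z),x,t)+l_3(l_2(y,t),x,z)-l_3(l_2(z,t),x,y)=0$. A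 homomorphism $\Phi=(\phi_0,\phi_1,\phi_2)$ from $\mathcal{G}=(\mathfrak{g}_1\xrightarrow{d}\mathfrak{g}_0,l_2,l_3)$ to $\mathcal{H}=(\mathfrak{h}_1\xrightarrow{d'}\mathfrak{h}_0,l'_2,l'_3)$ consists of linear maps $\phi_0:\mathfrak{g}_0\to\mathfrak{h}_0$, $\phi_1:\mathfrak{g}_1\to\mathfrak{h}_1$ and a skew-symmetric bilinear map $\phi_2:\mathfrak{g}_0\otimes\mathfrak{g}_0\to\mathfrak{h}_1$ such that (c.p. meaning the remaining cyclic permutations of $x,y,z$): (i) $\phi_0\circ d=d'\circ\phi_1$; (ii) $d'\phi_2(x,y)=\phi_0(l_2(x,y))-l'_2(\phi_0(x),\phi_0(y))$; (iii) $\phi_2(x,dp)=\phi_1(l_2(x,p))-l'_2(\phi_0(x),\phi_1(p))$; (iv) $l'_2(\phi_0(x),\phi_2(y,z))+c.p.+\phi_2(x,l_2(y,z))+c.p.=\phi_1(l_3(x,y,z))-l'_3(\phi_0(x),\phi_0(y),\phi_0(z))$. A $2$-term morphism sh Lie algebra is a triple $(\mathcal{G},\mathcal{H},\Phi)$ of two $2$-term sh Lie algebras and a homomorphism $\Phi:\mathcal{G}\to\mathcal{H}$. It is a skeletal morphism sh Lie algebra if $d=0$ and $d'=0$. Equivalence. Let $(\mathcal{G},\mathcal{H},\Phi)$ be a skeletal morphism sh Lie algebra, with $\mathcal{G}=(\mathfrak{g}_1\xrightarrow{0}\mathfrak{g}_0,l_2,l_3)$, $\mathcal{H}=(\mathfrak{h}_1\xrightarrow{0}\mathfrak{h}_0,l'_2,l'_3)$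 and $\Phi=(\phi_0,\phi_1,\phi_2)$. Given skew-symmetric bilinear maps $\sigma:\mathfrak{g}_0\otimes\mathfrak{g}_0\to\mathfrak{g}_1$, $\sigma':\mathfrak{h}_0\otimes\mathfrak{h}_0\to\mathfrak{h}_1$ and a linear map $\phi:\mathfrak{g}_0\to\mathfrak{h}_1$, define $\underline{l_3}(x,y,z)=l_3(x,y,z)+\{l_2(x,\sigma(y,z))+c.p.\}+\{\sigma(x,l_2(y,z))+c.p.\}$, $\underline{l'_3}(h,j,k)=l'_3(h,j,k)+\{l'_2(h,\sigma'(j,k))+c.p.\}+\{\sigma'(h,l'_2(j,k))+c.p.\}$, $\underline{\phi_2}(x,y)=\phi_2(x,y)+\phi_1(\sigma(x,y))-\sigma'(\phi_0(x),\phi_0(y))-l'_2(\phi_0(x),\phi(y))-l'_2(\phi(x),\phi_0(y))+\phi(l_2(x,y))$. Then $\underline{\mathcal{G}}=(\mathfrak{g}_1\xrightarrow{0}\mathfrak{g}_0,l_2,\underline{l_3})$, $\underline{\mathcal{H}}=(\mathfrak{h}_1\xrightarrow{0}\mathfrak{h}_0,l'_2,\underline{l'_3})$, $\underline{\Phi}=(\phi_0,\phi_1,\underline{\phi_2})$ form a skeletal morphism sh Lie algebra, and $(\mathcal{G},\mathcal{H},\Phi)$ and $(\underline{\mathcal{G}},\underline{\mathcal{H}},\underline{\Phi})$ are said to be equivalent. *)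

(* Defs.v *)
From mathcomp Require Import all_boot all_algebra.

Set Implicit Arguments.
Unset Strict Implicit.
Unset Printing Implicit Defensive.

Import GRing.Theory.
Local Open Scope ring_scope.

(* Vector spaces over [k] are [lmodType k], with no finiteness assumption.    *)

Notation bilinear f := (bilinear_for *:%R *:%R f).

Definition trilinear (k : fieldType) (U1 U2 U3 V : lmodType k)
    (f : U1 -> U2 -> U3 -> V) : Prop :=
  [/\ forall y z, linear (fun x => f x y z),
      forall x z, linear (fun y => f x y z)
    & forall x y, linear (fun z => f x y z)].

Definition skew2 (T : Type) (V : zmodType) (f : T -> T -> V) : Prop :=
  forall x y, f x y = - f y x.

Definition skew3 (T : Type) (V : zmodType) (f : T -> T -> T -> V) : Prop :=
  (forall x y z, f x y z = - f y x z) /\ (forall x y z, f x y z = - f x z y).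

(* Meant for [R] an equivalence relation, whose classes are then the          *)
(* predicates [R x].                                                          *)
Definition quotient (T : Type) (R : T -> T -> Prop) : Type :=
  {A : T -> Prop | exists x, A = R x}.

Definition class_of (T : Type) (R : T -> T -> Prop) (x : T) : quotient R :=
  exist _ (R x) (ex_intro _ x erefl).

(* ** Lie algebras, representations, morphism Lie algebras                    *)

Record lieAlgebra (k : fieldType) := LieAlgebra {
  lie_sort :> lmodType k;
  lie_br : lie_sort -> lie_sort -> lie_sort;
  lie_bilinear : bilinear lie_br;
  lie_alternating : forall x, lie_br x x = 0;
  lie_jacobi : forall x y z,
    lie_br x (lie_br y z) + lie_br y (lie_br z x) + lie_br z (lie_br x y) = 0
}.

Record lieRep (k : fieldType) (g : lieAlgebra k) := LieRep {
  rep_sort :> lmodType k;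
  rep_act : g -> rep_sort -> rep_sort;
  rep_bilinear : bilinear rep_act;
  rep_br : forall x y v,
    rep_act (lie_br x y) v = rep_act x (rep_act y v) - rep_act y (rep_act x v)
}.

Record morLie (k : fieldType) := MorLie {
  ml_dom : lieAlgebra k;
  ml_cod : lieAlgebra k;
  ml_map : ml_dom -> ml_cod;
  ml_linear : linear ml_map;
  ml_br : forall x y, ml_map (lie_br x y) = lie_br (ml_map x) (ml_map y)
}.

Record morRep (k : fieldType) (M : morLie k) := MorRep {
  mr_dom : lieRep (ml_dom M);
  mr_cod : lieRep (ml_cod M);
  mr_map : mr_dom -> mr_cod;
  mr_linear : linear mr_map;
  mr_act : forall x v,
    mr_map (rep_act x v) = rep_act (ml_map x) (mr_map v)
}.

Section Pullback.
Variables (k : fieldType) (M : morLie k) (W : lieRep (ml_cod M)).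

Let act (x : ml_dom M) (w : W) : W := rep_act (ml_map x) w.

Let act_bilinear : bilinear act.
Proof.
split=> [w a x y|x]; last exact: (rep_bilinear W).2.
by rewrite /act ml_linear (rep_bilinear W).1.
Qed.

Let act_br x y w : act (lie_br x y) w = act x (act y w) - act y (act x w).
Proof. by rewrite /act ml_br rep_br. Qed.

Definition pullback_rep : lieRep (ml_dom M) := LieRep act_bilinear act_br.

End Pullback.

(* ** Cochains and differentials                                              *)

(* An [n]-tuple of vectors is a function ['I_n -> g]. Hom(/\^n g, V) is the   *)
(* set of functions [f : ('I_n -> g) -> V] with [alternating_map f].          *)
Definition alternating_map (k : fieldType) (g V : lmodType k) (n : nat)
    (f : ('I_n -> g) -> V) : Prop :=
  (forall (x : 'I_n -> g) (i : 'I_n), linear (fun u => f [eta x with i |-> u]))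
  /\ (forall (x : 'I_n -> g) (i j : 'I_n), i != j -> x i = x j -> f x = 0).

(* The arguments ([x_i, x_j], x_0, .., ^x_i, .., ^x_j, .., x_n), for [i < j]: *)
(* [bump j \o bump i] is the increasing enumeration of the naturals other     *)
(* than [i] and [j].                                                          *)
Definition ce_bracket_args (k : fieldType) (g : lieAlgebra k) (n : nat)
    (x : 'I_n.+1 -> g) (i j : 'I_n.+1) : 'I_n -> g :=
  fun m => if (m : nat) is m'.+1 then x (inord (bump j (bump i m')))
           else lie_br (x i) (x j).

(* Indices start at 0, so the classical signs (-1)^(i+1) and (-1)^(i+j) for   *)
(* indices starting at 1 become (-1)^i and (-1)^(i+j).                        *)
Definition ce_diff (k : fieldType) (g : lieAlgebra k) (V : lieRep g) (n : nat)
    (f : ('I_n -> g) -> V) (x : 'I_n.+1 -> g) : V :=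
  \sum_(i < n.+1) (-1) ^+ i *: rep_act (x i) (f (fun m => x (lift i m)))
  + \sum_(i < n.+1) \sum_(j < n.+1 | (i < j)%N)
      (-1) ^+ (i + j) *: f (ce_bracket_args x i j).

(* The degree is shifted: [mcochain R m] with the predicate [is_mcochain]     *)
(* describes C^(m+1)_mLA.                                                     *)
Record mcochain (k : fieldType) (M : morLie k) (R : morRep M) (m : nat) :=
  MCochain {
  mc_theta : ('I_m.+1 -> ml_dom M) -> mr_dom R;
  mc_gamma : ('I_m.+1 -> ml_cod M) -> mr_cod R;
  mc_eta : ('I_m -> ml_dom M) -> mr_cod R
}.

Section MorphismComplex.
Variables (k : fieldType) (M : morLie k) (R : morRep M).

Definition is_mcochain (m : nat) (c : mcochain R m) : Prop :=
  [/\ alternating_map (mc_theta c), alternating_map (mc_gamma c)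
    & alternating_map (mc_eta c)].

Definition mcochain0 (m : nat) : mcochain R m :=
  MCochain (fun=> 0) (fun=> 0) (fun=> 0).

Definition mcochain_sub (m : nat) (c c' : mcochain R m) : mcochain R m :=
  MCochain (fun x => mc_theta c x - mc_theta c' x)
           (fun x => mc_gamma c x - mc_gamma c' x)
           (fun x => mc_eta c x - mc_eta c' x).

Definition mLA_diff (m : nat) (c : mcochain R m) : mcochain R m.+1 :=
  MCochain
    (ce_diff (mc_theta c))
    (ce_diff (mc_gamma c))
    (fun x => mr_map (mc_theta c x) - mc_gamma c (fun i => ml_map (x i))
              - ce_diff (V := pullback_rep (mr_cod R)) (mc_eta c) x).

(* Z^(m+1)_mLA *)
Record mcocycle (m : nat) := MCocycle {
  mcocycle_val :> mcochain R m;
  mcocycle_cochain : is_mcochain mcocycle_val;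
  mcocycle_diff : mLA_diff mcocycle_val = mcochain0 m.+1
}.

Definition cohomologous (m : nat) (z z' : mcocycle m.+1) : Prop :=
  exists2 b : mcochain R m, is_mcochain b & mcochain_sub z' z = mLA_diff b.

(* H^(m+2)_mLA = Z^(m+2)_mLA / mLA_diff (C^(m+1)_mLA) *)
Definition mcohomology (m : nat) : Type := quotient (@cohomologous m).

End MorphismComplex.

(* ** 2-term sh Lie algebras, their homomorphisms, morphism sh Lie algebras   *)

(* The suffixes of [sh_l] are the degrees of the arguments of l_2.            *)
Record shLie_data (k : fieldType) := ShLieData {
  sh0 : lmodType k;
  sh1 : lmodType k;
  sh_d : sh1 -> sh0;
  sh_l00 : sh0 -> sh0 -> sh0;
  sh_l01 : sh0 -> sh1 -> sh1;
  sh_l10 : sh1 -> sh0 -> sh1;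
  sh_l3 : sh0 -> sh0 -> sh0 -> sh1
}.

Record is_shLie (k : fieldType) (G : shLie_data k) : Prop := IsShLie {
  sh_d_linear : linear (@sh_d k G);
  sh_l00_bilinear : bilinear (@sh_l00 k G);
  sh_l01_bilinear : bilinear (@sh_l01 k G);
  sh_l10_bilinear : bilinear (@sh_l10 k G);
  sh_l00_skew : skew2 (@sh_l00 k G);
  sh_l01_skew : forall (x : sh0 G) (p : sh1 G), sh_l01 x p = - sh_l10 p x;
  sh_l3_trilinear : trilinear (@sh_l3 k G);
  sh_l3_skew : skew3 (@sh_l3 k G);
  sh_d_l2 : forall (x : sh0 G) (p : sh1 G),
    sh_d (sh_l01 x p) = sh_l00 x (sh_d p);
  sh_l2_d : forall p q : sh1 G, sh_l01 (sh_d p) q = sh_l10 p (sh_d q);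
  sh_d_l3 : forall x y z : sh0 G,
    sh_d (sh_l3 x y z) =
    sh_l00 x (sh_l00 y z) + sh_l00 y (sh_l00 z x) + sh_l00 z (sh_l00 x y);
  sh_l3_d : forall (x y : sh0 G) (p : sh1 G),
    sh_l3 x y (sh_d p) =
    sh_l01 x (sh_l01 y p) + sh_l01 y (sh_l10 p x) + sh_l10 p (sh_l00 x y);
  sh_l3_jacobi : forall x y z t : sh0 G,
    sh_l01 x (sh_l3 y z t) - sh_l01 y (sh_l3 x z t)
    + sh_l01 z (sh_l3 x y t) - sh_l01 t (sh_l3 x y z)
    - sh_l3 (sh_l00 x y) z t + sh_l3 (sh_l00 x z) y t
    - sh_l3 (sh_l00 x t) y z - sh_l3 (sh_l00 y z) x t
    + sh_l3 (sh_l00 y t) x z - sh_l3 (sh_l00 z t) x y = 0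
}.

Record shHom_data (k : fieldType) (G H : shLie_data k) := ShHomData {
  sh_f0 : sh0 G -> sh0 H;
  sh_f1 : sh1 G -> sh1 H;
  sh_f2 : sh0 G -> sh0 G -> sh1 H
}.

Record is_shHom (k : fieldType) (G H : shLie_data k) (F : shHom_data G H)
    : Prop := IsShHom {
  sh_f0_linear : linear (sh_f0 F);
  sh_f1_linear : linear (sh_f1 F);
  sh_f2_bilinear : bilinear (sh_f2 F);
  sh_f2_skew : skew2 (sh_f2 F);
  sh_f0_d : forall p, sh_f0 F (sh_d p) = sh_d (sh_f1 F p);
  sh_d_f2 : forall x y,
    sh_d (sh_f2 F x y) =
    sh_f0 F (sh_l00 x y) - sh_l00 (sh_f0 F x) (sh_f0 F y);
  sh_f2_d : forall x p,
    sh_f2 F x (sh_d p) =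
    sh_f1 F (sh_l01 x p) - sh_l01 (sh_f0 F x) (sh_f1 F p);
  sh_f2_l3 : forall x y z,
    (sh_l01 (sh_f0 F x) (sh_f2 F y z) + sh_l01 (sh_f0 F y) (sh_f2 F z x)
     + sh_l01 (sh_f0 F z) (sh_f2 F x y))
    + (sh_f2 F x (sh_l00 y z) + sh_f2 F y (sh_l00 z x)
       + sh_f2 F z (sh_l00 x y)) =
    sh_f1 F (sh_l3 x y z) - sh_l3 (sh_f0 F x) (sh_f0 F y) (sh_f0 F z)
}.

Record morShLie_data (k : fieldType) := MorShLieData {
  msh_dom : shLie_data k;
  msh_cod : shLie_data k;
  msh_hom : shHom_data msh_dom msh_cod
}.

Record is_morShLie (k : fieldType) (S : morShLie_data k) : Prop :=
  IsMorShLie {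
  msh_dom_shLie : is_shLie (msh_dom S);
  msh_cod_shLie : is_shLie (msh_cod S);
  msh_hom_shHom : is_shHom (msh_hom S)
}.

Definition is_skeletal (k : fieldType) (S : morShLie_data k) : Prop :=
  (forall p : sh1 (msh_dom S), sh_d p = 0)
  /\ (forall p : sh1 (msh_cod S), sh_d p = 0).

Record skelMorShLie (k : fieldType) := SkelMorShLie {
  skel_data :> morShLie_data k;
  skel_morShLie : is_morShLie skel_data;
  skel_skeletal : is_skeletal skel_data
}.

(* ** Equivalence of skeletal morphism sh Lie algebras                        *)

Definition shLie_twist (k : fieldType) (G : shLie_data k)
    (s : sh0 G -> sh0 G -> sh1 G) : shLie_data k :=
  ShLieData (@sh_d k G) (@sh_l00 k G) (@sh_l01 k G) (@sh_l10 k G)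
    (fun x y z =>
       sh_l3 x y z
       + (sh_l01 x (s y z) + sh_l01 y (s z x) + sh_l01 z (s x y))
       + (s x (sh_l00 y z) + s y (sh_l00 z x) + s z (sh_l00 x y))).

Definition morShLie_twist (k : fieldType) (S : morShLie_data k)
    (s : sh0 (msh_dom S) -> sh0 (msh_dom S) -> sh1 (msh_dom S))
    (s' : sh0 (msh_cod S) -> sh0 (msh_cod S) -> sh1 (msh_cod S))
    (f : sh0 (msh_dom S) -> sh1 (msh_cod S)) : morShLie_data k :=
  let F := msh_hom S in
  @MorShLieData k (shLie_twist s) (shLie_twist s')
    (@ShHomData k (shLie_twist s) (shLie_twist s') (sh_f0 F) (sh_f1 F)
       (fun x y =>
          sh_f2 F x y + sh_f1 F (s x y) - s' (sh_f0 F x) (sh_f0 F y)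
          - sh_l01 (sh_f0 F x) (f y) - sh_l10 (f x) (sh_f0 F y)
          + f (sh_l00 x y))).

Definition skel_equiv (k : fieldType) (S S' : skelMorShLie k) : Prop :=
  exists s s' f,
    [/\ bilinear s /\ skew2 s, bilinear s' /\ skew2 s', linear f
      & skel_data S' = @morShLie_twist k S s s' f].

Definition skel_class (k : fieldType) : Type := quotient (@skel_equiv k).

(* ** Triples                                                                 *)

Record mLA_triple (k : fieldType) := MLATriple {
  tr_mor : morLie k;
  tr_rep : morRep tr_mor;
  tr_cocycle : mcocycle tr_rep 2
}.

Record mLA_class_triple (k : fieldType) := MLAClassTriple {
  ctr_mor : morLie k;
  ctr_rep : morRep ctr_mor;
  ctr_class : mcohomology ctr_rep 1
}.

Definition class_triple (k : fieldType) (T : mLA_triple k)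
    : mLA_class_triple k :=
  MLAClassTriple (class_of (@cohomologous k _ _ 1) (tr_cocycle T)).

(* The data of the skeletal morphism sh Lie algebra attached to a triple,     *)
(* with [l_2(p, x) = - x . p] for [p] of degree 1.                            *)
Definition shLie_of_rep (k : fieldType) (g : lieAlgebra k) (V : lieRep g)
    (f : ('I_3 -> g) -> V) : shLie_data k :=
  @ShLieData k g V (fun=> 0) (@lie_br k g) (@rep_act k g V)
    (fun p x => - rep_act x p) (fun x y z => f (tnth [tuple x; y; z])).

Definition morShLie_of_triple (k : fieldType) (T : mLA_triple k)
    : morShLie_data k :=
  let c := tr_cocycle T in
  @MorShLieData k (shLie_of_rep (mc_theta c)) (shLie_of_rep (mc_gamma c))
    (@ShHomData k (shLie_of_rep (mc_theta c)) (shLie_of_rep (mc_gamma c))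
       (@ml_map k (tr_mor T)) (@mr_map k (tr_mor T) (tr_rep T))
       (fun x y => mc_eta c (tnth [tuple x; y]))).

(* Main.v *)
(* A skeletal 2-term sh Lie algebra (d = 0) is a Lie algebra g_0 acting on    *)
(* g_1 together with l_3, and identity (v) is the 3-cocycle condition on l_3; *)
(* for a homomorphism, the identity relating phi_2 to l_3 and l'_3 is the     *)
(* last component of the cocycle condition on (l_3, l'_3, phi_2). Twisting by *)
(* (sigma, sigma', phi) adds to this cocycle the coboundary of                *)
(* (sigma, sigma', phi), so two skeletal objects are equivalent iff their     *)
(* triples have the same class in H^3.                                        *)

From mathcomp Require Import all_boot all_algebra boolp.
(* [Defs] comes last so that its notation [bilinear] shadows MathComp's. *)
Require Import Defs.

Set Implicit Arguments.
Unset Strict Implicit.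
Unset Printing Implicit Defensive.

Import GRing.Theory.
Local Open Scope ring_scope.

(** With d = 0 and d' = 0, identities (iii) and (iv) of a 2-term sh Lie algebra become the Jacobi
    identity and the action axiom, and (ii) and (iii) of a homomorphism say that phi_0 is a Lie
    algebra homomorphism and phi_1 is equivariant. The identities that remain say that (l_3, l'_3,
    phi_2) is a 3-cocycle ([cochain_of_cocycle], [morShLie_of_tripleP]); characteristic 0 enters as
    2 != 0, which makes skew-symmetric maps alternating. No data is lost in either direction
    ([cochain_ofK], [morShLie_of_triple_inj]), which gives the first bijection.

    A twist keeps the Lie algebras and representations and replaces the cocycle c by c +
    delta(sigma, sigma', phi) ([cochain_data_twist]). Hence equivalence of skeletal objects is the
    kernel relation of the surjection onto class triples ([class_triple_skel_equiv]), and such a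
    surjection induces a bijection from the quotient ([quotient_bijection]). *)

(** * Functions of several variables as functions on tuples *)

Definition uncurry1 (T U : Type) (f : T -> U) (x : 'I_1 -> T) : U := f (x 0).

Definition uncurry2 (T U : Type) (f : T -> T -> U) (x : 'I_2 -> T) : U :=
  f (x 0) (x 1).

Definition uncurry3 (T U : Type) (f : T -> T -> T -> U) (x : 'I_3 -> T) : U :=
  f (x 0) (x 1) (x 2).

Lemma ord2P (i : 'I_2) : i = 0 \/ i = 1.
Proof. by case: i => -[|[|//]] lti; [left|right]; apply: val_inj. Qed.

Lemma ord3P (i : 'I_3) : [\/ i = 0, i = 1 | i = 2].
Proof.
case: i => -[|[|[|//]]] lti; [apply: Or31|apply: Or32|apply: Or33];
  exact: val_inj.
Qed.

Lemma tnth1K (T : Type) (x : 'I_1 -> T) : tnth [tuple x 0] = x.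
Proof. by apply: funext => i; rewrite (ord1 i). Qed.

Lemma tnth2K (T : Type) (x : 'I_2 -> T) : tnth [tuple x 0; x 1] = x.
Proof. by apply: funext => i; case: (ord2P i) => ->. Qed.

Lemma tnth3K (T : Type) (x : 'I_3 -> T) : tnth [tuple x 0; x 1; x 2] = x.
Proof. by apply: funext => i; case: (ord3P i) => ->. Qed.

Lemma tnth4K (T : Type) (x : 'I_4 -> T) : tnth [tuple x 0; x 1; x 2; x 3] = x.
Proof.
by apply: funext => -[[|[|[|[|//]]]] lti]; congr x; apply: val_inj.
Qed.

Lemma sum_ord2 (V : zmodType) (F : 'I_2 -> V) : \sum_i F i = F 0 + F 1.
Proof.
by rewrite !big_ord_recl big_ord0 addr0; congr (_ + F _); apply: val_inj.
Qed.

Lemma sum_ord3 (V : zmodType) (F : 'I_3 -> V) : \sum_i F i = F 0 + F 1 + F 2.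
Proof.
by rewrite big_ord_recl sum_ord2 addrA; congr (_ + F _ + F _); apply: val_inj.
Qed.

Lemma sum_ord4 (V : zmodType) (F : 'I_4 -> V) :
  \sum_i F i = F 0 + F 1 + F 2 + F 3.
Proof.
rewrite big_ord_recl sum_ord3 !addrA.
by congr (_ + F _ + F _ + F _); apply: val_inj.
Qed.

Definition sum_ordE := (sum_ord4, sum_ord3, sum_ord2).

(** * The Chevalley-Eilenberg differential in degrees 1, 2 and 3 *)

Section CEDiff.
Variables (k : fieldType) (g : lieAlgebra k) (V : lieRep g).

Lemma ce_diff_uncurry1 (f : g -> V) x y :
  ce_diff (uncurry1 f) (tnth [tuple x; y]) =
  rep_act x (f y) - rep_act y (f x) - f (lie_br x y).
Proof.
rewrite /ce_diff /uncurry1 /ce_bracket_args sum_ordE.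
(* The condition [i < j] becomes a conditional, so that both sums can be expanded over all indices
   and the excluded pairs vanish by computation. *)
under eq_bigr do rewrite big_mkcond sum_ordE.
rewrite sum_ordE !(tnth_nth x) /=.
by rewrite ?(addr0, add0r, expr0, expr1, scale1r, scaleN1r).
Qed.

Lemma ce_diff_uncurry2 (f : g -> g -> V) x y z :
  ce_diff (uncurry2 f) (tnth [tuple x; y; z]) =
  rep_act x (f y z) - rep_act y (f x z) + rep_act z (f x y)
    - f (lie_br x y) z + f (lie_br x z) y - f (lie_br y z) x.
Proof.
rewrite /ce_diff /uncurry2 /ce_bracket_args sum_ordE.
under eq_bigr do rewrite big_mkcond sum_ordE.
rewrite sum_ordE /= !(tnth_nth x) !inordK //=.
rewrite !(addr0, add0r) !exprS !expr0 ?(mulr1, mulrNN).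
by rewrite !(scale1r, scaleN1r) ?addrA.
Qed.

Lemma ce_diff_uncurry3 (f : g -> g -> g -> V) x y z t :
  ce_diff (uncurry3 f) (tnth [tuple x; y; z; t]) =
  rep_act x (f y z t) - rep_act y (f x z t)
    + rep_act z (f x y t) - rep_act t (f x y z)
    - f (lie_br x y) z t + f (lie_br x z) y t
    - f (lie_br x t) y z - f (lie_br y z) x t
    + f (lie_br y t) x z - f (lie_br z t) x y.
Proof.
rewrite /ce_diff /uncurry3 /ce_bracket_args sum_ordE.
under eq_bigr do rewrite big_mkcond sum_ordE.
rewrite sum_ordE /= !(tnth_nth x) !inordK //=.
rewrite !(addr0, add0r) !exprS !expr0 ?(mulr1, mulrNN).
by rewrite !(scale1r, scaleN1r) ?addrA.
Qed.

End CEDiff.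

(** * Alternating and skew-symmetric multilinear maps *)

Section Multilinear.
Variable k : fieldType.

Lemma linear_fun0 (U V : lmodType k) (f : U -> V) : linear f -> f 0 = 0.
Proof.
by move=> lf; have := lf (-1) 0 0; rewrite scaler0 addr0 scaleN1r addNr.
Qed.

Lemma linear_funD (U V : lmodType k) (f : U -> V) :
  linear f -> {morph f : x y / x + y}.
Proof. by move=> lf x y; have := lf 1 x y; rewrite !scale1r. Qed.

Lemma linear_funN (U V : lmodType k) (f : U -> V) :
  linear f -> {morph f : x / - x}.
Proof.
move=> lf x; have := lf (-1) x 0.
by rewrite (linear_fun0 lf) !addr0 !scaleN1r.
Qed.

(** Polarization: expand f(x + y, x + y) = 0. *)
Lemma alternating_skew2 (U V : lmodType k) (f : U -> U -> V) :
  bilinear f -> (forall x, f x x = 0) -> skew2 f.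
Proof.
move=> lf alt x y; apply/eqP; rewrite -addr_eq0; apply/eqP.
have := alt (x + y).
rewrite (linear_funD (lf.1 _)) !(linear_funD (lf.2 _)) !alt.
by rewrite add0r addr0.
Qed.

Hypothesis two_neq0 : 2 != 0 :> k.

Lemma skew2_alternating (U V : lmodType k) (f : U -> U -> V) :
  skew2 f -> forall x, f x x = 0.
Proof.
move=> skf x; have /eqP : f x x + f x x = 0 by rewrite {1}skf addNr.
by rewrite -mulr2n -scaler_nat scaler_eq0 (negPf two_neq0) => /eqP.
Qed.

Lemma alternating_map_uncurry1 (U V : lmodType k) (f : U -> V) :
  alternating_map (uncurry1 f) <-> linear f.
Proof.
split=> [[lf _]|lf]; first exact: (lf (fun=> 0) 0).
split=> [x i|x i j]; last by rewrite (ord1 i) (ord1 j) eqxx.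
by rewrite (ord1 i).
Qed.

Lemma alternating_map_uncurry2 (U V : lmodType k) (f : U -> U -> V) :
  alternating_map (uncurry2 f) <-> bilinear f /\ skew2 f.
Proof.
split=> [[lf alt]|[lf skf]].
  have bf : bilinear f.
    (* The entry 0 of the tuple is a placeholder: it stands at the index being varied and is
       overwritten. *)
    split=> u; first exact: (lf (tnth [tuple 0; u]) 0).
    exact: (lf (tnth [tuple u; 0]) 1).
  split=> //; apply: (alternating_skew2 bf) => x.
  exact: (alt (tnth [tuple x; x]) 0 1).
split=> [x i|x i j].
  by case: (ord2P i) => ->; [exact: lf.1 | exact: lf.2].
have altf := skew2_alternating skf.
by case: (ord2P i) => ->; case: (ord2P j) => ->; rewrite ?eqxx //;
  rewrite /uncurry2 => _ ->; apply: altf.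
Qed.

Lemma alternating_map_uncurry3 (U V : lmodType k) (f : U -> U -> U -> V) :
  alternating_map (uncurry3 f) <-> trilinear f /\ skew3 f.
Proof.
split=> [[lf alt]|[[lf1 lf2 lf3] [sk12 sk23]]].
  have tf : trilinear f.
    split=> u v; first exact: (lf (tnth [tuple 0; u; v]) 0).
      exact: (lf (tnth [tuple u; 0; v]) 1).
    exact: (lf (tnth [tuple u; v; 0]) 2).
  have [lf1 lf2 lf3] := tf; split=> //; split=> x y z.
    apply: (@alternating_skew2 _ _ (fun x y => f x y z)).
      by split=> u; [exact: lf1 | exact: lf2].
    move=> u; exact: (alt (tnth [tuple u; u; z]) 0 1).
  apply: (@alternating_skew2 _ _ (f x)).
    by split=> u; [exact: lf2 | exact: lf3].
  move=> u; exact: (alt (tnth [tuple x; u; u]) 1 2).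
split=> [x i|x i j].
  by case: (ord3P i) => ->; [exact: lf1 | exact: lf2 | exact: lf3].
have alt12 u v : f u u v = 0.
  exact: (@skew2_alternating _ _ (fun x y => f x y v)).
have alt23 u v : f u v v = 0 by exact: skew2_alternating (sk23 u) v.
have alt13 u v : f u v u = 0 by rewrite sk23 alt12 oppr0.
by case: (ord3P i) => ->; case: (ord3P j) => ->; rewrite ?eqxx //;
  rewrite /uncurry3 => _ ->.
Qed.

End Multilinear.

(** * The 3-cocycle condition in terms of multilinear maps *)

Section Cocycle.
Variables (k : fieldType) (two_neq0 : 2 != 0 :> k).

Lemma lie_skew (g : lieAlgebra k) : skew2 (@lie_br k g).
Proof. exact: alternating_skew2 (lie_bilinear g) (@lie_alternating k g). Qed.

(** Skew-symmetry of [f] and of the bracket absorbs the signs of the six terms, which leaves the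
    cyclic sums used for homomorphisms and twists. *)
Lemma ce_diff_cyclic (g : lieAlgebra k) (V : lieRep g) (f : g -> g -> V) x y z :
  bilinear f -> skew2 f ->
  ce_diff (uncurry2 f) (tnth [tuple x; y; z]) =
  (rep_act x (f y z) + rep_act y (f z x) + rep_act z (f x y))
  + (f x (lie_br y z) + f y (lie_br z x) + f z (lie_br x y)).
Proof.
move=> lf sf; rewrite ce_diff_uncurry2.
rewrite (sf x z) (linear_funN ((rep_bilinear V).2 _)) opprK.
rewrite (lie_skew x z) (linear_funN (lf.1 _)) -!sf -!addrA.
by do 3!congr (_ + _); rewrite addrC [X in X + _]addrC -addrA.
Qed.

Variables (M : morLie k) (R : morRep M).
Variables (theta : ml_dom M -> ml_dom M -> ml_dom M -> mr_dom R).
Variables (gamma : ml_cod M -> ml_cod M -> ml_cod M -> mr_cod R).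
Variables (eta : ml_dom M -> ml_dom M -> mr_cod R).

Let c : mcochain R 2 :=
  MCochain (uncurry3 theta) (uncurry3 gamma) (uncurry2 eta).

Lemma is_mcochain_uncurry :
  is_mcochain c <->
  [/\ trilinear theta /\ skew3 theta, trilinear gamma /\ skew3 gamma
    & bilinear eta /\ skew2 eta].
Proof.
by split=> -[t g e]; split;
  apply/(alternating_map_uncurry3 two_neq0) ||
    apply/(alternating_map_uncurry2 two_neq0).
Qed.

Lemma mLA_diff_uncurry_eq0 : bilinear eta -> skew2 eta ->
  mLA_diff c = mcochain0 R 3 <->
  [/\ forall x y z t, ce_diff (uncurry3 theta) (tnth [tuple x; y; z; t]) = 0,
      forall x y z t, ce_diff (uncurry3 gamma) (tnth [tuple x; y; z; t]) = 0
    & forall x y z,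
        (rep_act (ml_map x) (eta y z) + rep_act (ml_map y) (eta z x)
           + rep_act (ml_map z) (eta x y))
        + (eta x (lie_br y z) + eta y (lie_br z x) + eta z (lie_br x y)) =
        mr_map (theta x y z) - gamma (ml_map x) (ml_map y) (ml_map z)].
Proof.
move=> le se.
have dE := @ce_diff_cyclic _ (pullback_rep (mr_cod R)) eta _ _ _ le se.
split=> [dc|[dt dg de]]; first split=> x y z => [t|t|].
- exact: (congr1 (fun c => mc_theta c (tnth [tuple x; y; z; t])) dc).
- exact: (congr1 (fun c => mc_gamma c (tnth [tuple x; y; z; t])) dc).
- have /subr0_eq := congr1 (fun c => mc_eta c (tnth [tuple x; y; z])) dc.
  by rewrite dE => /esym.
congr MCochain; apply: funext => x; rewrite /=.
- by rewrite -(tnth4K x) dt.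
- by rewrite -(tnth4K x) dg.
- by rewrite -(tnth3K x) dE /= de subrr.
Qed.

End Cocycle.

(** * Skeletal objects and triples determine each other *)

Section Triples.
Variables (k : fieldType) (two_neq0 : 2 != 0 :> k).

(** The axioms are propositions about raw data, so that by proof irrelevance the bundled structures
    built from them depend on the data alone. *)
Record lie_conditions (G : shLie_data k) : Prop := LieConditions {
  lc_bilinear : bilinear (@sh_l00 k G);
  lc_alternating : forall x, @sh_l00 k G x x = 0;
  lc_jacobi : forall x y z : sh0 G,
    sh_l00 x (sh_l00 y z) + sh_l00 y (sh_l00 z x) + sh_l00 z (sh_l00 x y) = 0;
  lc_act_bilinear : bilinear (@sh_l01 k G);
  lc_act_br : forall (x y : sh0 G) (p : sh1 G),
    sh_l01 (sh_l00 x y) p = sh_l01 x (sh_l01 y p) - sh_l01 y (sh_l01 x p)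
}.

Definition lie_of (G : shLie_data k) (P : lie_conditions G) : lieAlgebra k :=
  LieAlgebra (lc_bilinear P) (lc_alternating P) (lc_jacobi P).

Definition rep_of (G : shLie_data k) (P : lie_conditions G) :
    lieRep (lie_of P) :=
  @LieRep k (lie_of P) (sh1 G) (@sh_l01 k G)
    (lc_act_bilinear P) (lc_act_br P).

Record mor_conditions (D : morShLie_data k) : Prop := MorConditions {
  mc_dom : lie_conditions (msh_dom D);
  mc_cod : lie_conditions (msh_cod D);
  mc_linear : linear (sh_f0 (msh_hom D));
  mc_br : forall x y,
    sh_f0 (msh_hom D) (sh_l00 x y) =
    sh_l00 (sh_f0 (msh_hom D) x) (sh_f0 (msh_hom D) y);
  mc_rep_linear : linear (sh_f1 (msh_hom D));
  mc_rep_act : forall x p,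
    sh_f1 (msh_hom D) (sh_l01 x p) =
    sh_l01 (sh_f0 (msh_hom D) x) (sh_f1 (msh_hom D) p)
}.

Definition morLie_of (D : morShLie_data k) (P : mor_conditions D) : morLie k :=
  @MorLie k (lie_of (mc_dom P)) (lie_of (mc_cod P)) (sh_f0 (msh_hom D))
    (mc_linear P) (mc_br P).

Definition morRep_of (D : morShLie_data k) (P : mor_conditions D) :
    morRep (morLie_of P) :=
  @MorRep k (morLie_of P) (rep_of (mc_dom P)) (rep_of (mc_cod P))
    (sh_f1 (msh_hom D)) (mc_rep_linear P) (mc_rep_act P).

Definition cochain_of (D : morShLie_data k) (P : mor_conditions D) :
    mcochain (morRep_of P) 2 :=
  @MCochain k _ (morRep_of P) 2
    (uncurry3 (@sh_l3 k (msh_dom D))) (uncurry3 (@sh_l3 k (msh_cod D)))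
    (uncurry2 (sh_f2 (msh_hom D))).

Record triple_conditions (D : morShLie_data k) : Prop := TripleConditions {
  tc_mor : mor_conditions D;
  tc_cochain : is_mcochain (cochain_of tc_mor);
  tc_diff : mLA_diff (cochain_of tc_mor) = mcochain0 (morRep_of tc_mor) 3
}.

Definition triple_of (D : morShLie_data k) (P : triple_conditions D) :
    mLA_triple k :=
  MLATriple (MCocycle (tc_cochain P) (tc_diff P)).

Lemma triple_conditions_ext (D D' : morShLie_data k) (P : triple_conditions D)
    (P' : triple_conditions D') :
  D = D' -> triple_of P = triple_of P'.
Proof. by move=> E; case: _ / E P' => P'; rewrite (Prop_irrelevance P P'). Qed.

(** The construction of [morShLie_of_triple], extended to cochains that are not yet known to be
    cocycles. *)
Definition cochain_data (M : morLie k) (R : morRep M) (c : mcochain R 2) :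
    morShLie_data k :=
  @MorShLieData k (shLie_of_rep (mc_theta c)) (shLie_of_rep (mc_gamma c))
    (@ShHomData k (shLie_of_rep (mc_theta c)) (shLie_of_rep (mc_gamma c))
       (@ml_map k M) (@mr_map k M R) (fun x y => mc_eta c (tnth [tuple x; y]))).

Lemma uncurry_cochain (M : morLie k) (R : morRep M) (c : mcochain R 2) :
  exists theta gamma eta,
    c = MCochain (uncurry3 theta) (uncurry3 gamma) (uncurry2 eta).
Proof.
case: c => t g e.
exists (fun a b c => t (tnth [tuple a; b; c])),
  (fun a b c => g (tnth [tuple a; b; c])), (fun a b => e (tnth [tuple a; b])).
by congr MCochain; apply: funext => x;
  rewrite /uncurry3 /uncurry2 ?tnth3K ?tnth2K.
Qed.

(* The conclusion ranges over all cochains: proofs about a cochain with       *)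
(* arbitrary bundled coefficients may thus be carried out on raw data, where  *)
(* no transport along equalities of Lie algebras is needed.                   *)
Lemma cochain_of_ind (Q : forall M (R : morRep M), mcochain R 2 -> Prop) :
  (forall D (P : mor_conditions D), cochain_data (cochain_of P) = D ->
     Q (morLie_of P) (morRep_of P) (cochain_of P)) ->
  forall M (R : morRep M) (c : mcochain R 2), Q M R c.
Proof.
move=> QP M R c; have [t [g [e ->]]] := uncurry_cochain c.
case: M R t g e {c} => -[g0 g1 g2 g3 g4] [h0 h1 h2 h3 h4] m0 m1 m2.
case=> -[V0 V1 V2 V3] [W0 W1 W2 W3] r0 r1 r2 t g e.
(* The zero differential and the sign in degree (1, 0) are those of [shLie_of_rep], so that the
   premise [cochain_data (cochain_of P) = D] holds by computation. *)
pose G := @ShLieData k g0 V0 (fun=> 0) g1 V1 (fun p x => - V1 x p) t.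
pose H := @ShLieData k h0 W0 (fun=> 0) h1 W1 (fun p x => - W1 x p) g.
pose PG := @LieConditions G g2 g3 g4 V2 V3.
pose PH := @LieConditions H h2 h3 h4 W2 W3.
pose D := MorShLieData (@ShHomData k G H m0 r0 e).
exact: (QP D (@MorConditions D PG PH m1 m2 r1 r2)).
Qed.

(** The components that the cochain and its coefficients do not record are d and l_2(p, x);
    skeletality forces the first to be 0 and skew-symmetry forces the second to be - l_2(x, p). *)
Lemma cochain_ofK (D : morShLie_data k) (P : mor_conditions D) :
  is_morShLie D -> is_skeletal D -> cochain_data (cochain_of P) = D.
Proof.
case: D P => -[g0 g1 d l00 l01 l10 l3] [h0 h1 d' m00 m01 m10 m3] [f0 f1 f2] P.
case=> /= sG sH _ [/= d0 d'0].
have Ed : d = fun=> 0 by apply: funext.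
have Ed' : d' = fun=> 0 by apply: funext.
have El : l10 = fun p x => - l01 x p.
  do 2!apply: funext => ?.
  by rewrite [RHS](congr1 _ (sh_l01_skew sG _ _)) opprK.
have Em : m10 = fun p x => - m01 x p.
  do 2!apply: funext => ?.
  by rewrite [RHS](congr1 _ (sh_l01_skew sH _ _)) opprK.
by move: P {sG sH}; rewrite {}Ed {}Ed' {}El {}Em.
Qed.

(** Once [T] is reduced to raw data, its two cocycle properties are the missing conditions, and
    rebuilding the triple gives [T] itself. *)
Lemma triple_ofK (T : mLA_triple k) :
  exists P : triple_conditions (morShLie_of_triple T), triple_of P = T.
Proof.
case: T => M R [c cc dc]; rewrite /morShLie_of_triple -/(cochain_data c) /=.
elim/cochain_of_ind: c cc dc => D P DE cc dc; rewrite DE.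
by exists (TripleConditions cc dc).
Qed.

Lemma morShLie_of_triple_inj : injective (@morShLie_of_triple k).
Proof.
move=> T T' E; have [P <-] := triple_ofK T; have [P' <-] := triple_ofK T'.
exact: triple_conditions_ext.
Qed.

(** For d = 0 the left-hand sides of (iii) and (iv) vanish; (iii) is then the Jacobi identity and
    (iv) the action axiom. *)
Lemma shLie_lie_conditions (G : shLie_data k) :
  is_shLie G -> (forall p : sh1 G, sh_d p = 0) -> lie_conditions G.
Proof.
move=> sG d0; split.
- exact: sh_l00_bilinear.
- exact: skew2_alternating (sh_l00_skew sG).
- by move=> x y z; rewrite -(sh_d_l3 sG) d0.
- exact: sh_l01_bilinear.
move=> x y p; have := sh_l3_d sG x y p.
have [_ _ l3] := sh_l3_trilinear sG.
have Np q u : sh_l10 q u = - sh_l01 u q :> sh1 G.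
  by rewrite (sh_l01_skew sG) opprK.
rewrite d0 (linear_fun0 (l3 _ _)) !Np (linear_funN ((sh_l01_bilinear sG).2 _)).
by move/esym/subr0_eq.
Qed.

Lemma skeletal_mor_conditions (D : morShLie_data k) :
  is_morShLie D -> is_skeletal D -> mor_conditions D.
Proof.
case=> sG sH sF [d0 d'0]; split.
- exact: shLie_lie_conditions.
- exact: shLie_lie_conditions.
- exact: sh_f0_linear.
- by move=> x y; apply/subr0_eq; rewrite -(sh_d_f2 sF) d'0.
- exact: sh_f1_linear.
move=> x p; apply/subr0_eq; rewrite -(sh_f2_d sF) d0.
exact: linear_fun0 ((sh_f2_bilinear sF).2 _).
Qed.

Lemma cochain_of_cocycle (D : morShLie_data k) (P : mor_conditions D) :
  is_morShLie D ->
  is_mcochain (cochain_of P)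
  /\ mLA_diff (cochain_of P) = mcochain0 (morRep_of P) 3.
Proof.
move=> [sG sH sF]; split.
  apply/(is_mcochain_uncurry two_neq0); split; split.
  - exact: sh_l3_trilinear sG.
  - exact: sh_l3_skew sG.
  - exact: sh_l3_trilinear sH.
  - exact: sh_l3_skew sH.
  - exact: sh_f2_bilinear sF.
  - exact: sh_f2_skew sF.
apply/mLA_diff_uncurry_eq0.
- exact: sh_f2_bilinear sF.
- exact: sh_f2_skew sF.
split=> [x y z t|x y z t|x y z].
- rewrite ce_diff_uncurry3; exact: (sh_l3_jacobi sG).
- rewrite ce_diff_uncurry3; exact: (sh_l3_jacobi sH).
exact: (sh_f2_l3 sF).
Qed.

Lemma skeletal_triple_conditions (D : morShLie_data k) :
  is_morShLie D -> is_skeletal D -> triple_conditions D.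
Proof.
move=> mD sD; have P := skeletal_mor_conditions mD sD.
by have [] := cochain_of_cocycle P mD; exists P.
Qed.

(** Carries [cochain_of_cocycle] over to given bundled coefficients; it recognises a cocycle from
    the sh data it produces. *)
Lemma cochain_data_cocycle (M : morLie k) (R : morRep M) (c : mcochain R 2) :
  is_morShLie (cochain_data c) -> is_mcochain c /\ mLA_diff c = mcochain0 R 3.
Proof.
by elim/cochain_of_ind: c => D P ->; apply: cochain_of_cocycle.
Qed.

(** Identities (i) and (ii) are trivial for d = 0; (iii) is the Jacobi identity, (iv) the action
    axiom and (v) the cocycle condition [df]. *)
Lemma shLie_of_repP (g : lieAlgebra k) (V : lieRep g) (f : g -> g -> g -> V) :
  trilinear f -> skew3 f ->
  (forall x y z t, ce_diff (uncurry3 f) (tnth [tuple x; y; z; t]) = 0) ->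
  is_shLie (shLie_of_rep (uncurry3 f)).
Proof.
move=> lf sf df; have [lf1 lf2 lf3] := lf; have [actl actr] := rep_bilinear V.
split=> //=.
- by move=> a x y; rewrite scaler0 addr0.
- exact: lie_bilinear.
- by split=> u a x y /=; rewrite (actl, actr) opprD scalerN.
- exact: lie_skew.
- by move=> x p; rewrite opprK.
- by move=> x p; rewrite (linear_fun0 ((lie_bilinear g).2 _)).
- by move=> p q; rewrite !(linear_fun0 (actl _)) oppr0.
- by move=> x y z; rewrite lie_jacobi.
- move=> x y p; rewrite /uncurry3 /= (linear_fun0 (lf3 _ _)).
  by rewrite (linear_funN (actr _)) -rep_br subrr.
by move=> x y z t; have := df x y z t; rewrite ce_diff_uncurry3.
Qed.

Lemma morShLie_of_tripleP (T : mLA_triple k) :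
  is_morShLie (morShLie_of_triple T) /\ is_skeletal (morShLie_of_triple T).
Proof.
split=> //; case: T => M R [z cz dz].
have [t [g [e Ez]]] := uncurry_cochain z; subst z.
have [[lt st] [lg sg] [le se]] := (is_mcochain_uncurry two_neq0 _ _ _).1 cz.
have [dt dg de] := (mLA_diff_uncurry_eq0 _ _ le se).1 dz.
split=> /=; try exact: shLie_of_repP.
have l0 := @linear_fun0 k _ _ _ (le.2 _).
split=> //=.
- exact: ml_linear.
- exact: mr_linear.
- by move=> _; rewrite (linear_fun0 (@ml_linear k M)).
- by move=> x y; rewrite ml_br subrr.
- by move=> x p; rewrite mr_act subrr; exact: l0.
Qed.

End Triples.

(** * Quotients and induced bijections *)

Section Quotients.
Variables (T : Type) (R : T -> T -> Prop).

Lemma quotientP (A : quotient R) : exists x, class_of R x = A.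
Proof.
by case: A => A AP; have [x Ax] := AP; exists x; apply: eq_exist.
Qed.

(** A reflexive Euclidean relation is an equivalence relation: [R y x] follows from [R x y] and
    [R x x]. *)
Lemma class_of_eq x y :
  (forall x, R x x) -> (forall x y z, R x y -> R x z -> R y z) ->
  R x y <-> class_of R x = class_of R y.
Proof.
move=> Rxx Reucl; split=> [Rxy|/(congr1 sval)/= ->]; last exact: Rxx.
apply: eq_exist; apply: funext => z; apply: propext; split.
  exact: (Reucl x y z Rxy).
exact: (Reucl y x z (Reucl x y x Rxy (Rxx x))).
Qed.

(** As the kernel relation of [q], [R] is an equivalence relation, so [q] factors injectively
    through the quotient. Representatives of classes and preimages under [q] are picked by choice
    ([cid]). *)
Lemma quotient_bijection (U : Type) (q : T -> U) :
  (forall x y, R x y <-> q x = q y) -> (forall u, exists x, q x = u) ->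
  exists Qbar : quotient R -> U,
    bijective Qbar /\ forall x, Qbar (class_of R x) = q x.
Proof.
move=> Rq q_surj.
have classE x y : R x y <-> class_of R x = class_of R y.
  apply: class_of_eq => [z|a b c]; rewrite !Rq //.
  by move=> ->.
pose r A := sval (cid (quotientP A)).
have rK A : class_of R (r A) = A by rewrite /r; case: cid.
pose s u := sval (cid (q_surj u)).
have sK u : q (s u) = u by rewrite /s; case: cid.
have qr x : q (r (class_of R x)) = q x by apply/Rq/classE.
exists (q \o r); split=> //; exists (class_of R \o s) => [A|u] /=.
  by rewrite -[RHS]rK; apply/classE/Rq.
by rewrite qr.
Qed.

End Quotients.

(** * Being cohomologous is an equivalence relation *)

Section Cohomologous.
Variables (k : fieldType) (M : morLie k) (R : morRep M).

Lemma alternating_map_sub (g V : lmodType k) n (f f' : ('I_n -> g) -> V) :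
  alternating_map f -> alternating_map f' ->
  alternating_map (fun x => f x - f' x).
Proof.
move=> [lf af] [lf' af']; split=> [x i a u v|x i j ij xij].
  by rewrite lf lf' opprD addrACA scalerBr.
by rewrite (af _ i j) // (af' _ i j) // subrr.
Qed.

Lemma alternating_map0 (g V : lmodType k) n :
  alternating_map (fun _ : 'I_n -> g => 0 : V).
Proof. by split=> // x i a u v; rewrite scaler0 addr0. Qed.

Lemma ce_diff_sub (g : lieAlgebra k) (V : lieRep g) n
    (f f' : ('I_n -> g) -> V) x :
  ce_diff (fun y => f y - f' y) x = ce_diff f x - ce_diff f' x.
Proof.
rewrite /ce_diff opprD addrACA -!sumrB; congr (_ + _); apply: eq_bigr => i _.
  have actr := (rep_bilinear V).2 (x i).
  by rewrite (linear_funD actr) (linear_funN actr) scalerBr.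
by rewrite -sumrB; apply: eq_bigr => j _; rewrite scalerBr.
Qed.

Lemma is_mcochain_sub n (b b' : mcochain R n) :
  is_mcochain b -> is_mcochain b' -> is_mcochain (mcochain_sub b b').
Proof. by move=> [? ? ?] [? ? ?]; split; apply: alternating_map_sub. Qed.

Lemma mLA_diff_sub n (b b' : mcochain R n) :
  mLA_diff (mcochain_sub b b') = mcochain_sub (mLA_diff b) (mLA_diff b').
Proof.
congr MCochain; apply: funext => x /=; rewrite ce_diff_sub //.
rewrite (linear_funD (@mr_linear k M R)) (linear_funN (@mr_linear k M R)).
rewrite !opprD !opprK [RHS]addrACA; congr (_ + _).
by rewrite [RHS]addrACA.
Qed.

Lemma cohomologous_refl n (z : mcocycle R n.+1) : cohomologous z z.
Proof.
have c0 : is_mcochain (mcochain0 R n) by split; apply: alternating_map0.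
(* The zero cochain is written as a difference so that [mLA_diff_sub] shows its differential to be
   zero. *)
exists (mcochain_sub (mcochain0 R n) (mcochain0 R n)).
  exact: is_mcochain_sub.
by rewrite mLA_diff_sub; congr MCochain; apply: funext => x; rewrite /= !subrr.
Qed.

Lemma cohomologous_eucl n (z1 z2 z3 : mcocycle R n.+1) :
  cohomologous z1 z2 -> cohomologous z1 z3 -> cohomologous z2 z3.
Proof.
(* The witness comes from z3 - z2 = (z3 - z1) - (z2 - z1). *)
move=> [b cb zb] [b' cb' zb']; exists (mcochain_sub b' b).
  exact: is_mcochain_sub.
rewrite mLA_diff_sub -zb -zb'.
by congr MCochain; apply: funext => x /=; rewrite opprB addrA subrK.
Qed.

Lemma cohomologousE n (z z' : mcocycle R n.+1) :
  cohomologous z z' <->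
  class_of (@cohomologous k M R n) z = class_of (@cohomologous k M R n) z'.
Proof. exact: class_of_eq (@cohomologous_refl n) (@cohomologous_eucl n). Qed.

End Cohomologous.

(** * Equivalence of skeletal objects is equality of cohomology classes *)

Section Equivalence.
Variables (k : fieldType) (two_neq0 : 2 != 0 :> k).

(** The cyclic sums that the twist adds to l_3 and l'_3 are the differentials of [s] and [s']. The
    terms added to phi_2 form the last component of the coboundary, where l'_2(phi(x), phi_0(y))
    equals - phi_0(y) . phi(x). *)
Lemma cochain_data_twist (M : morLie k) (R : morRep M) (c c' : mcochain R 2)
    s s' f :
  bilinear s -> skew2 s -> bilinear s' -> skew2 s' ->
  mcochain_sub c' c =
    mLA_diff
      (MCochain (uncurry2 s) (uncurry2 s') (uncurry1 f) : mcochain R 1) ->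
  cochain_data c' = @morShLie_twist k (cochain_data c) s s' f.
Proof.
move=> ls ss ls' ss' E.
have Et : (fun x y z => mc_theta c' (tnth [tuple x; y; z])) =
    sh_l3 (s := @shLie_twist k (shLie_of_rep (mc_theta c)) s).
  apply: funext => x; apply: funext => y; apply: funext => z /=.
  have /(canRL (subrK _)) -> :=
    congr1 (fun b => mc_theta b (tnth [tuple x; y; z])) E.
  by rewrite /= ce_diff_cyclic // addrC addrA.
have Eg : (fun x y z => mc_gamma c' (tnth [tuple x; y; z])) =
    sh_l3 (s := @shLie_twist k (shLie_of_rep (mc_gamma c)) s').
  apply: funext => x; apply: funext => y; apply: funext => z /=.
  have /(canRL (subrK _)) -> :=
    congr1 (fun b => mc_gamma b (tnth [tuple x; y; z])) E.
  by rewrite /= ce_diff_cyclic // addrC addrA.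
have Ee : (fun x y => mc_eta c' (tnth [tuple x; y])) =
    sh_f2 (msh_hom (@morShLie_twist k (cochain_data c) s s' f)).
  apply: funext => x; apply: funext => y /=.
  have /(canRL (subrK _)) -> :=
    congr1 (fun b => mc_eta b (tnth [tuple x; y])) E.
  rewrite /= (@ce_diff_uncurry1 _ _ (pullback_rep (mr_cod R))).
  by rewrite addrC !opprD !opprK !addrA.
by rewrite /cochain_data /shLie_of_rep Et Eg Ee.
Qed.

Lemma class_triple_twist (T T' : mLA_triple k) s s' f :
  bilinear s -> skew2 s -> bilinear s' -> skew2 s' -> linear f ->
  morShLie_of_triple T' = @morShLie_twist k (morShLie_of_triple T) s s' f ->
  class_triple T = class_triple T'.
Proof.
case: T s s' f => M R z s s' f ls ss ls' ss' lf E.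
pose b : mcochain R 1 := MCochain (uncurry2 s) (uncurry2 s') (uncurry1 f).
(* The cocycle of [T] plus the coboundary of [b], over the same coefficients as [T]. *)
pose c' : mcochain R 2 :=
  MCochain (fun x => mc_theta (mLA_diff b) x + mc_theta z x)
           (fun x => mc_gamma (mLA_diff b) x + mc_gamma z x)
           (fun x => mc_eta (mLA_diff b) x + mc_eta z x).
have c'B : mcochain_sub c' z = mLA_diff b.
  by congr MCochain; apply: funext => x; rewrite /= addrK.
have c'E := cochain_data_twist ls ss ls' ss' c'B.
(* By the hypothesis [E], [c'] produces the morphism sh Lie algebra of [T'], hence is a cocycle;
   injectivity then identifies [T'] with the triple of [c']. *)
have [|cc' dc'] := @cochain_data_cocycle k two_neq0 M R c'.
  by rewrite c'E -E; apply: (morShLie_of_tripleP two_neq0 T').1.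
have {E} -> : T' = MLATriple (MCocycle cc' dc').
  by apply: morShLie_of_triple_inj; rewrite E -c'E.
congr MLAClassTriple; apply/cohomologousE; exists b => //.
by split; rewrite ?alternating_map_uncurry1 ?alternating_map_uncurry2.
Qed.

Lemma class_triple_eq (T T' : mLA_triple k) :
  class_triple T = class_triple T' ->
  exists2 z' : mcocycle (tr_rep T) 2,
    T' = MLATriple z' & cohomologous (tr_cocycle T) z'.
Proof.
move=> E.
(* The equality of dependent triples cannot be split componentwise; instead a property that holds
   for the class triple of [T'] is transported along it. *)
pose Q (X : mLA_class_triple k) :=
  exists2 z' : mcocycle (ctr_rep X) 2,
    T' = MLATriple z' & ctr_class X = class_of (@cohomologous k _ _ 1) z'.
have : Q (class_triple T') by exists (tr_cocycle T') => //; case: (T').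
by rewrite -E => -[z' Tz' /cohomologousE zz']; exists z'.
Qed.

Lemma class_triple_skel_equiv (S S' : skelMorShLie k) (T T' : mLA_triple k) :
  morShLie_of_triple T = S -> morShLie_of_triple T' = S' ->
  skel_equiv S S' <-> class_triple T = class_triple T'.
Proof.
rewrite /skel_equiv => <- <-; split=> [[s [s' [f [[ls ss] [ls' ss'] lf]]]]|].
  exact: class_triple_twist.
move/class_triple_eq => [z' -> [b [cs cs' cf] zb]].
(* The twisting maps are the three components of a cochain [b] whose coboundary is the difference of
   the cocycles. *)
pose s x y := mc_theta b (tnth [tuple x; y]).
pose s' x y := mc_gamma b (tnth [tuple x; y]).
pose f x := mc_eta b (tnth [tuple x]).
have sE : mc_theta b = uncurry2 s.
  by apply: funext => x; rewrite /uncurry2 /s tnth2K.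
have s'E : mc_gamma b = uncurry2 s'.
  by apply: funext => x; rewrite /uncurry2 /s' tnth2K.
have fE : mc_eta b = uncurry1 f.
  by apply: funext => x; rewrite /uncurry1 /f tnth1K.
move: cs cs' cf; rewrite sE s'E fE.
move=> /(alternating_map_uncurry2 two_neq0)[ls ss].
move=> /(alternating_map_uncurry2 two_neq0)[ls' ss'].
move=> /alternating_map_uncurry1 lf.
exists s, s', f; split=> //; apply: cochain_data_twist => //.
by rewrite -sE -s'E -fE zb; case: (b).
Qed.

End Equivalence.

(** * The bijections on objects and on classes *)

Lemma skelMorShLie_inj (k : fieldType) : injective (@skel_data k).
Proof.
case=> D m s [D' m' s'] /= E; case: _ / E m' s' => m' s'.
by rewrite (Prop_irrelevance m m') (Prop_irrelevance s s').
Qed.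

Theorem theorem6p4 (k : fieldType) (char0 : [pchar k] =i pred0) :
  exists F : skelMorShLie k -> mLA_triple k,
    [/\ bijective F,
        forall S : skelMorShLie k, morShLie_of_triple (F S) = skel_data S
      & exists Fbar : skel_class k -> mLA_class_triple k,
          bijective Fbar /\
          forall S : skelMorShLie k,
            Fbar (class_of (@skel_equiv k) S) = class_triple (F S)].
Proof.
have two_neq0 : 2 != 0 :> k by rewrite ((pcharf0P k).1 char0).
pose F S := triple_of
  (skeletal_triple_conditions two_neq0 (skel_morShLie S) (skel_skeletal S)).
have FE S : morShLie_of_triple (F S) = skel_data S.
  by apply: cochain_ofK; [exact: skel_morShLie | exact: skel_skeletal].
pose G T := SkelMorShLie (morShLie_of_tripleP two_neq0 T).1
  (morShLie_of_tripleP two_neq0 T).2.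
have GK : cancel G F by move=> T; apply: morShLie_of_triple_inj; rewrite FE.
exists F; split=> //.
  by exists G => // S; apply: skelMorShLie_inj; rewrite /= FE.
apply: quotient_bijection => [S S'|[M R A]].
  exact: class_triple_skel_equiv.
(* Surjectivity onto class triples: a representative cocycle of [A] gives a triple, which comes from
   a skeletal object. *)
have [z <-] := quotientP A.
by exists (G (MLATriple z)); rewrite GK.
Qed.
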